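(* Let $\mathcal{I}$ be a nontrivial admissible ideal of subsets of $\mathbb{N}$. The topological space $(\mathbb{R},\mathfrak{T}_{\mathcal{I}})$ is not normal.
   Context: $m$ denotes Lebesgue measure on $\mathbb{R}$. An ideal $\mathcal{I}$ of subsets of $\mathbb{N}=\{1,2,\dots\}$ is a nonempty family closed under finite unions and under subsets; it is nontrivial if $\mathcal{I}\neq\{\emptyset\}$ and $\mathbb{N}\notin\mathcal{I}$, and admissible if it contains all singletons. $\mathcal{F}(\mathcal{I})=\{M\subset\mathbb{N}:\mathbb{N}\setminus M\in\mathcal{I}\}$. For a bounded real sequence $x=(x_n)$: $\mathcal{I}\text{-}\liminf x=\inf\{a\in\mathbb{R}:\{k:x_k<a\}\notin\mathcal{I}\}$. Let $E\subset\mathbb{R}$ be Lebesgue measurable and $p\in\mathbb{R}$. Consider sequences $(J_n)_{n\in\mathbb{N}}$ of closed intervals with $p\in J_n$ for all $n$ and $\{n\in\mathbb{N}:0<m(J_n)<\frac1n\}\in\mathcal{F}(\mathcal{I})$. For such a sequence put $x_n=\frac{m(J_n\cap E)}{m(J_n)}$ (with $x_n:=0$ if $m(J_n)\in\{0,\infty\}$; such $n$ form a set in $\mathcal{I}$ and do not matter). The lower $\mathcal{I}$-density $\mathcal{I}\text{-}d_-(p,E)$ is the infimum of $\mathcal{I}\text{-}\liminf x_n$ over all such sequences $(J_n)$. $\mathfrak{T}_{\mathcal{I}}$ (the $\mathcal{I}$-density topology on $\mathbb{R}$) is the collection of Lebesgue measurable sets $A\subset\mathbb{R}$ with $\mathcal{I}\text{-}d_-(x,A)=1$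 for all $x\in A$; it is a topology. *)

(* Defs.v *)
From HB Require Import structures.
From mathcomp Require Import all_boot all_order all_algebra.
From mathcomp Require Import all_classical all_reals all_analysis.
From mathcomp Require Import measurable_realfun lra.

Set Implicit Arguments.
Unset Strict Implicit.
Unset Printing Implicit Defensive.
Import Order.TTheory GRing.Theory Num.Theory.
Import numFieldNormedType.Exports.
Local Open Scope classical_set_scope.
Local Open Scope ring_scope.

(* The index set {1, 2, ...} is represented by nat through n |-> n.+1: ideals
   live on nat, and the n-th term of a sequence carries the bound n.+1%:R^-1. *)
Definition ideal (I : set_system nat) : Prop :=
  [/\ I !=set0,
      forall A B, I A -> I B -> I (A `|` B) &
      forall A B, A `<=` B -> I B -> I A].

Definition nontrivial (I : set_system nat) : Prop :=
  I <> [set set0] /\ ~ I setT.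

Definition admissible (I : set_system nat) : Prop := forall n, I [set n].

Definition dual_filter (I : set_system nat) : set_system nat :=
  [set M | I (~` M)].

(* For a bounded sequence x and an ideal I not containing setT, the set below
   is nonempty and bounded from below, so that [inf] is a genuine infimum. *)
Definition ideal_liminf (R : realType) (I : set_system nat) (x : R^nat) : R :=
  inf [set a | ~ I [set k | x k < a]].

(* The Borel measurable sets are the default ones on R; the Lebesgue measurable
   sets are the Caratheodory ones, on which completed_lebesgue_measure lives. *)
Definition lebesgue_measurable (R : realType) : set_system R :=
  (wlength (@idfun R))^*%mu.-cara.-measurable.

Local Notation mu := completed_lebesgue_measure.

(* Closed intervals may be degenerate or unbounded. *)
Definition shrinking_intervals (R : realType) (I : set_system nat) (p : R) :
    set (set R)^nat :=
  [set J : (set R)^nat |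
    (forall n, [/\ is_interval (J n), closed (J n) & J n p]) /\
    dual_filter I [set n | (0 < mu (J n))%E /\
                           (mu (J n) < (n.+1%:R^-1)%:E)%E]].

(* Equal to 0 when mu J is 0 or +oo, since [fine +oo = 0] and [x / 0 = 0]. *)
Definition relative_measure (R : realType) (E J : set R) : R :=
  fine (mu (J `&` E)) / fine (mu J).

Definition lower_density (R : realType) (I : set_system nat) (p : R)
    (E : set R) : R :=
  inf [set ideal_liminf I (fun n => relative_measure E (J n))
      | J in shrinking_intervals I p].

Definition density_open (R : realType) (I : set_system nat) : set_system R :=
  [set A | lebesgue_measurable A /\
           forall x, A x -> lower_density I x A = 1].

(* Ordinary density along closed intervals; by lower_density1P below it agrees
   with I-density 1 on Lebesgue measurable sets. *)
Definition full_density (R : realType) (A : set R) (x : R) : Prop :=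
  forall e : R, 0 < e -> exists2 d : R, 0 < d &
  forall J : set R, is_interval J -> closed J -> J x -> (0 < mu J)%E ->
    (mu J < d%:E)%E -> (mu (J `\` A) <= e%:E * mu J)%E.

Section density_topology.
Context {R : realType} {I : set_system nat}.
Hypotheses (idealI : ideal I) (nontrivialI : nontrivial I)
  (admissibleI : admissible I).
Implicit Types (A B E J : set R) (x : R).

Let I0 : I set0.
Proof. by case: idealI => -[A IA] _ sI; exact: sI IA. Qed.

Let IT : ~ I setT. Proof. by case: nontrivialI. Qed.

Let I_lt n : I [set k | (k < n)%N].
Proof.
have [_ IU sI] := idealI.
elim: n => [|n IH]; first by apply: sI I0 => k.
apply: sI (IU _ _ IH (admissibleI n)) => k /=.
by rewrite ltnS leq_eqVlt => /orP[/eqP->|]; [right|left].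
Qed.

Let mu_ge0 A : (0 <= mu A)%E.
Proof. exact: (@outer_measure_ge0 _ _ (wlength idfun)^*%mu). Qed.

Let le_mu A B : A `<=` B -> (mu A <= mu B)%E.
Proof. exact: (@le_outer_measure _ _ (wlength idfun)^*%mu). Qed.

Let muU A B : (mu (A `|` B) <= mu A + mu B)%E.
Proof. exact: (@outer_measureU2 _ _ (wlength idfun)^*%mu). Qed.

Let mu_split E A : lebesgue_measurable A ->
  mu E = (mu (E `&` A) + mu (E `\` A))%E.
Proof. by move=> mA; exact: mA. Qed.

Let rel_ge0 A J : 0 <= relative_measure A J.
Proof. by rewrite divr_ge0// fine_ge0. Qed.

Let finJ J : (mu J < +oo)%E -> mu J \is a fin_num.
Proof. by move=> Joo; rewrite ge0_fin_numE. Qed.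

Let rel_le1 A J : relative_measure A J <= 1.
Proof.
rewrite /relative_measure.
have [Joo|] := ltP (mu J) +oo%E; last first.
  by rewrite leye_eq => /eqP ->; rewrite /= invr0 mulr0.
have [->|J0] := eqVneq (fine (mu J)) 0; first by rewrite invr0 mulr0.
rewrite ler_pdivrMr; last by rewrite lt_neqAle eq_sym J0 fine_ge0.
rewrite mul1r fine_le//; [|exact: finJ|by apply: le_mu => y []].
by apply: finJ; apply: le_lt_trans Joo; apply: le_mu => y [].
Qed.

Let relE A J e : lebesgue_measurable A -> (0 < mu J)%E -> (mu J < +oo)%E ->
  (mu (J `\` A) <= e%:E * mu J)%E = (1 - e <= relative_measure A J).
Proof.
move=> mA J0 Joo; rewrite /relative_measure.
have fJ := finJ Joo.
have fA : mu (J `&` A) \is a fin_num.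
  by apply: finJ; apply: le_lt_trans Joo; apply: le_mu => y [].
have fD : mu (J `\` A) \is a fin_num.
  by apply: finJ; apply: le_lt_trans Joo; apply: le_mu => y [].
have := mu_split J mA; move: J0.
rewrite -(fineK fJ) -(fineK fA) -(fineK fD) /=.
set a := fine _; set b := fine _; set c := fine _.
rewrite lte_fin => a0 -[ab]; rewrite -EFinM lee_fin ler_pdivlMr//.
by apply/idP/idP; nra.
Qed.


Let sI (A B : set nat) : A `<=` B -> I B -> I A.
Proof. by case: idealI => _ _; exact. Qed.

Let IU (A B : set nat) : I A -> I B -> I (A `|` B).
Proof. by case: idealI => _ + _; exact. Qed.

Let liminf_lb A (J : (set R)^nat) :
  lbound [set a | ~ I [set k | relative_measure A (J k) < a]] 0.
Proof.
move=> a /= Ia; rewrite leNgt; apply/negP => a0; apply: Ia.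
apply: sI I0 => k /= /lt_trans/(_ a0).
by rewrite ltNge rel_ge0.
Qed.

Let liminf_ub A (J : (set R)^nat) a :
  [set a | ~ I [set k | relative_measure A (J k) < a]] a ->
  ideal_liminf I (fun n => relative_measure A (J n)) <= a.
Proof. by move=> Ia; apply: ge_inf => //; exists 0; exact: liminf_lb. Qed.

Let liminf_ne A (J : (set R)^nat) a : 1 < a ->
  [set a | ~ I [set k | relative_measure A (J k) < a]] a.
Proof.
move=> a1 /= Ia; apply: IT; apply: sI Ia => k _ /=.
exact: le_lt_trans (rel_le1 _ _) a1.
Qed.

Let liminf_ge A (J : (set R)^nat) c :
  lbound [set a | ~ I [set k | relative_measure A (J k) < a]] c ->
  c <= ideal_liminf I (fun n => relative_measure A (J n)).
Proof.
move=> cl; apply: lb_le_inf => //; exists 2; apply: liminf_ne; lra.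
Qed.

Let liminf_le1 A (J : (set R)^nat) :
  ideal_liminf I (fun n => relative_measure A (J n)) <= 1.
Proof.
apply/ler_addgt0Pr => e e0; apply: liminf_ub; apply: liminf_ne; lra.
Qed.

Let mu_segment x (r : R) : 0 <= r -> mu `[x - r, x + r] = (r *+ 2)%:E.
Proof.
move=> r0; transitivity (lebesgue_measure `[x - r, x + r]) => //.
rewrite lebesgue_measure_itv/= lte_fin.
have [rlt|rge] := ltP; first by rewrite -EFinD; congr EFin; lra.
by congr EFin; lra.
Qed.

Let segment_ok x (r : R) : 0 <= r ->
  [/\ is_interval `[x - r, x + r]%classic, closed `[x - r, x + r]%classic
    & `[x - r, x + r]%classic x].
Proof.
move=> r0; split; [exact: interval_is_interval|exact: interval_closed|].
by rewrite /= in_itv /=; lra.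
Qed.

Let shrinking_ne x : shrinking_intervals I x !=set0.
Proof.
pose h n : R := 3^-1 * n.+1%:R^-1.
have h0 n : 0 < h n by rewrite mulr_gt0// invr_gt0.
have hn n : h n *+ 2 < n.+1%:R^-1.
  by rewrite -mulrnAl gtr_pMl ?invr_gt0//; lra.
exists (fun n => `[x - h n, x + h n]%classic).
split=> [n|]; first exact: segment_ok (ltW (h0 n)).
apply: sI I0 => n /=; apply.
rewrite mu_segment; last exact: ltW.
by rewrite !lte_fin hn pmulrn_lgt0.
Qed.

Lemma lower_density1P A x : lebesgue_measurable A ->
  lower_density I x A = 1 <-> full_density A x.
Proof.
move=> mA; split => [d1|xA].
  apply: contrapT => /existsNP[e /not_implyP[e0 nd]].
  have inv0 n : 0 < n.+1%:R^-1 :> R by rewrite invr_gt0.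
  have /choice[J JP] : forall n : nat, exists J : set R,
      [/\ is_interval J, closed J & J x] /\
      [/\ (0 < mu J)%E, (mu J < (n.+1%:R^-1)%:E)%E
        & ~ (mu (J `\` A) <= e%:E * mu J)%E].
    move=> n; apply: contrapT => nJ; apply: nd; exists n.+1%:R^-1 => // J.
    move=> iJ cJ Jx J0 Jn; apply: contrapT => JA.
    by apply: nJ; exists J; split.
  have : lower_density I x A <= 1 - e.
    apply: (@le_trans _ _ (ideal_liminf I (fun n => relative_measure A (J n)))).
      apply: ge_inf.
        by exists 0 => _ [K _ <-]; apply: liminf_ge; exact: liminf_lb.
      exists J => //; split=> [n|]; first by have [] := JP n.
      by apply: sI I0 => n /=; apply; have [_ []] := JP n.
    apply: liminf_ub => /= Ie; apply: IT; apply: sI Ie => n _ /=.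
    have [_ [J0 Jn]] := JP n; rewrite relE//; last exact: lt_trans Jn (ltry _).
    by move/negP; rewrite -ltNge.
  by rewrite d1; lra.
have lim1 (J : (set R)^nat) : shrinking_intervals I x J ->
    ideal_liminf I (fun n => relative_measure A (J n)) = 1.
  move=> [Jx IJ]; apply/eqP; rewrite eq_le liminf_le1/=.
  apply/ler_addgt0Pr => e e0; rewrite -lerBlDr.
  apply: liminf_ge => a /=; apply: contra_notP => /negP; rewrite -ltNge => ae.
  have [d d0 dP] := xA e e0.
  have [N _ NP] := near_infty_natSinv_lt (PosNum d0).
  apply: sI (IU IJ (I_lt N)) => n /= na.
  have [nN|Nn] := ltnP n N; [by right|left => -[J0 Jn]].
  have [iJ cJ Jnx] := Jx n.
  have := dP _ iJ cJ Jnx J0.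
  rewrite relE//; last exact: lt_trans Jn (ltry _).
  have /[swap]/[apply] : (mu (J n) < d%:E)%E.
    by apply: lt_trans Jn _; rewrite lte_fin; exact: NP.
  by move=> /le_lt_trans/(_ na) /lt_trans/(_ ae); rewrite ltxx.
rewrite /lower_density (_ : [set _ | _ in _] = [set 1]) ?inf1//.
apply/seteqP; split=> [_ [J /lim1 + <-]//|_ ->].
by have [J xJ] := shrinking_ne x; exists J => //; exact: lim1.
Qed.

Lemma density_openE A : density_open I A <->
  lebesgue_measurable A /\ forall x, A x -> full_density A x.
Proof.
split=> -[mA AP]; split=> // x Ax.
  exact: (lower_density1P _ mA).1 (AP x Ax).
exact: (lower_density1P _ mA).2 (AP x Ax).
Qed.

Lemma density_openT : density_open I [set: R].
Proof.
apply/density_openE; split=> [|x _ e e0]; first exact: measurableT.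
exists 1 => // J _ _ _ J0 _.
by rewrite setDT [mu _]measure0 mule_ge0// ?lee_fin ltW.
Qed.

Lemma density_openI : setI_closed (@density_open R I).
Proof.
move=> A B /density_openE[mA Ad] /density_openE[mB Bd].
apply/density_openE; split=> [|x [Ax Bx] e e0]; first exact: measurableI.
have e20 : 0 < e / 2 by rewrite divr_gt0.
have [a a0 aP] := Ad x Ax _ e20; have [b b0 bP] := Bd x Bx _ e20.
exists (Num.min a b); first by rewrite lt_min a0.
move=> J iJ cJ Jx J0 Jab.
have := aP _ iJ cJ Jx J0; have := bP _ iJ cJ Jx J0.
have -> : (mu J < a%:E)%E.
  by apply: lt_le_trans Jab _; rewrite lee_fin ge_min lexx.
have -> : (mu J < b%:E)%E.
  by apply: lt_le_trans Jab _; rewrite lee_fin ge_min lexx orbT.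
move=> /(_ isT) Bj /(_ isT) Aj.
rewrite setDIr (le_trans (muU _ _))// (le_trans (leeD Aj Bj))//.
rewrite -ge0_muleDl ?lee_fin ?(ltW e20)// -EFinD.
by rewrite -splitr.
Qed.

Let full_densityS A B x : A `<=` B -> full_density A x -> full_density B x.
Proof.
move=> AB xA e e0; have [d d0 dP] := xA e e0; exists d => // J iJ cJ Jx J0 Jd.
by apply: le_trans (dP J iJ cJ Jx J0 Jd); apply: le_mu; exact: setDS.
Qed.

Lemma full_density_measurable A : (forall x, A x -> full_density A x) ->
  lebesgue_measurable A.
Proof.
move=> Ad.
suff mAN (N : nat) : lebesgue_measurable (A `&` ball (0 : R) N.+1%:R).
  rewrite (_ : A = \bigcup_N (A `&` ball (0 : R) N.+1%:R)).
    by apply: bigcupT_measurable => n; exact: mAN.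
  apply/seteqP; split=> [x Ax|x [n _] []//].
  exists (Num.trunc `|x|) => //; split=> //.
  by rewrite /ball/= sub0r normrN truncnS_gt.
set D := ball _ _.
have mball x r : measurable (ball x r) by exact: measurable_ball.
have mD : measurable D by exact: mball.
pose C := D `\` A.
have [F [oF CF muF]] := outer_measure_Gdelta C.
pose H := \bigcap_i F i `&` D.
have mH : measurable H.
  apply: measurableI => //; apply: bigcapT_measurable => i.
  exact: open_measurable.
have CH : C `<=` H by move=> x Cx; split; [exact: CF|exact: Cx.1].
have muCH : mu H = mu C.
  apply/eqP; rewrite eq_le (le_mu CH) andbT.
  apply: (@le_trans _ _ (mu (\bigcap_i F i))); first by apply: le_mu => x [].
  by rewrite le_eqVlt; apply/orP; left; apply/eqP; exact: muF.
have Doo : (mu D < +oo)%E.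
  rewrite (_ : mu D = lebesgue_measure D)// lebesgue_measure_ball//.
  by rewrite ltry.
have Hoo : (mu H < +oo)%E.
  by apply: le_lt_trans Doo; apply: le_mu => x [].
have hull E : measurable E -> (mu (H `&` E) <= mu (C `&` E))%E.
  move=> mE; have mE' : lebesgue_measurable E by exact: sub_caratheodory.
  have := mu_split H mE'; rewrite muCH (mu_split C mE') => eq1.
  have le1 : (mu (C `\` E) <= mu (H `\` E))%E by apply: le_mu; exact: setSD.
  have fHE : mu (H `\` E) \is a fin_num.
    by apply: finJ; apply: le_lt_trans Hoo; apply: le_mu => x [].
  by rewrite -(leeD2rE _ _ fHE) -eq1 leeD2l.
have negAH : (@lebesgue_measure R).-negligible (A `&` H).
  apply: negligibleS (lebesgue_density mH) => x [Ax Hx] /= dens.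
  have e0 : 0 < 4^-1 :> R by rewrite invr_gt0.
  have [d d0 dP] := Ad x Ax _ e0.
  move: dens; rewrite indicE mem_set// => dens.
  have : ((2^-1)%:E < 1%:E :> \bar R)%E by rewrite lte_fin; lra.
  apply/negP; rewrite -leNgt.
  apply: (cvge_to_le dens).
  near=> r.
  have r0 : 0 < r by near: r; exact: nbhs_right_gt.
  rewrite (lebesgue_measure_ball _ (ltW r0)).
  have [iJ cJ Jx] := segment_ok x (ltW r0).
  have r20 : 0 < r *+ 2 by rewrite pmulrn_lgt0.
  have r2d : r *+ 2 < d.
    rewrite mulr2n; have : r < d / 2; last lra.
    by near: r; apply: nbhs_right_lt; rewrite divr_gt0.
  have := dP _ iJ cJ Jx; rewrite (mu_segment x (ltW r0)) !lte_fin.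
  move=> /(_ r20 r2d) JA.
  have HJ : (lebesgue_measure (H `&` ball x r) <= (4^-1)%:E * (r *+ 2)%:E)%E.
    apply: le_trans JA; apply: le_trans (hull _ (mball _ _)) _.
    apply: le_mu => y [[_ nAy]]; rewrite /ball/= => xy; split=> //=.
    by rewrite in_itv/=; move: xy; rewrite ltr_norml; lra.
  rewrite inver gt_eqF//= lee_pdivrMr//; apply: le_trans HJ _.
  by rewrite -!EFinM lee_fin; nra.
have -> : A `&` D = (D `\` H) `|` (A `&` H).
  apply/seteqP; split=> [x [Ax Dx]|x [[Dx nHx]|[Ax [_ Dx]]]//].
    by have [Hx|nHx] := pselect (H x); [right|left].
  by split=> //; apply: contrapT => nAx; exact/nHx/CH.
apply: measurableU; first by apply: sub_caratheodory; exact: measurableD.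
apply: negligible_sub_caratheodory; case: negAH => B [mB B0 AHB].
by exists B; split=> //; exact: sub_caratheodory.
Unshelve. all: by end_near. Qed.

Lemma density_open_bigU (K : Type) (f : K -> set R) :
  (forall i, density_open I (f i)) -> density_open I (\bigcup_i f i).
Proof.
move=> fd; have Ud x : (\bigcup_i f i) x -> full_density (\bigcup_i f i) x.
  move=> [i _ fix_]; have [_ /(_ x fix_)] := (density_openE _).1 (fd i).
  by apply: full_densityS => y fiy; exists i.
by apply/density_openE; split=> //; exact: full_density_measurable.
Qed.

End density_topology.

(* The real line carrying the topology of the density-open sets. *)
Definition density_line (R : realType) (I : set_system nat) (idealI : ideal I)
  (nontrivialI : nontrivial I) (admissibleI : admissible I) : Type := R.

Section density_line.
Context (R : realType) (I : set_system nat) (idealI : ideal I)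
  (nontrivialI : nontrivial I) (admissibleI : admissible I).
Local Notation T := (@density_line R I idealI nontrivialI admissibleI).

HB.instance Definition _ := Choice.copy T R.
HB.instance Definition _ := isOpenTopological.Build T
  (density_openT idealI nontrivialI admissibleI)
  (density_openI idealI nontrivialI admissibleI)
  (density_open_bigU idealI nontrivialI admissibleI).

Lemma open_density_lineE (A : set T) : open A = density_open I (A : set R).
Proof. by []. Qed.

End density_line.

(* Main.v *)
Require Import Defs.
From mathcomp Require Import all_boot all_order all_algebra.
From mathcomp Require Import all_classical all_reals all_analysis.
From mathcomp Require Import lra.

Set Implicit Arguments.
Unset Strict Implicit.
Unset Printing Implicit Defensive.
Import Order.TTheory GRing.Theory Num.Theory.
Import numFieldNormedType.Exports.
Local Open Scope classical_set_scope.
Local Open Scope ring_scope.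

(** The I-density topology coincides with the ordinary density topology, in
    which every Lebesgue null set is closed. Let [A] be the set of rational
    numbers and [B] a null residual set that avoids [A]: the two sets are
    closed and disjoint, and no disjoint density-open sets [U] and [V] separate
    them.

    Indeed [V] has density 1 at every point of the residual set [B], and by the
    Baire category theorem this convergence is uniform on a set of points that
    is dense in some nonempty open set [O] ([residual_uniform_density]). An
    interval centered at a point of [O] contains such points, so that [V] fills
    most of every short interval centered anywhere in [O]. But [O] contains a
    rational number, around which the disjoint set [U] also fills most of every
    short interval. *)

Local Notation mu := completed_lebesgue_measure.

Section density.
Context {R : realType}.
Implicit Types (A B U V : set R) (x : R).

Let le_mu A B : A `<=` B -> (mu A <= mu B)%E.
Proof. exact: (@le_outer_measure _ _ (wlength idfun)^*%mu). Qed.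

Let muU A B : (mu (A `|` B) <= mu A + mu B)%E.
Proof. exact: (@outer_measureU2 _ _ (wlength idfun)^*%mu). Qed.

Let mu_ge0 A : (0 <= mu A)%E.
Proof. exact: (@outer_measure_ge0 _ _ (wlength idfun)^*%mu). Qed.

Let mu_segment x (r : R) : 0 < r -> mu `[x - r, x + r] = (r *+ 2)%:E.
Proof.
move=> r0; transitivity (lebesgue_measure `[x - r, x + r]) => //.
rewrite lebesgue_measure_itv/= lte_fin ifT; last lra.
by rewrite -EFinD; congr EFin; lra.
Qed.

Lemma full_density_null_setC A x : mu A = 0%E -> full_density (~` A) x.
Proof.
move=> A0 e e0; exists 1 => // J _ _ _ _ _.
rewrite setDE setCK (@le_trans _ _ 0%E) ?mule_ge0 ?lee_fin ?(ltW e0)//.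
by rewrite -A0; apply: le_mu => y [].
Qed.

(** The points at which the density bound already holds for all intervals
    shorter than [n.+1%:R^-1] cover a residual set as [n] varies, so by Baire
    they are dense in some nonempty open set for one [n]. The bound passes from
    these points to every center in that open set, because an interval around
    such a center contains one of them. *)
Lemma residual_uniform_density V (G : (set R)^nat) (e : R) : 0 < e ->
  (forall i, open (G i) /\ dense (G i)) ->
  (forall x, (\bigcap_i G i) x -> full_density V x) ->
  exists O : set R, [/\ open O, O !=set0 & exists2 d : R, 0 < d &
    forall (x r : R), O x -> 0 < r < d ->
      (mu (`[(x - r)%R, (x + r)%R] `\` V) <= (e * (r *+ 2))%:E)%E].
Proof.
move=> e0 odG GV.
pose D n : set R := [set x | forall J : set R, is_interval J -> closed J ->
  J x -> (0 < mu J)%E -> (mu J < (n.+1%:R^-1)%:E)%E ->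
  (mu (J `\` V) <= e%:E * mu J)%E].
have [n /denseNE [ O [[x [oO Ox]] OD]]] : exists n, ~ dense (~` closure (D n)).
  apply/existsNP => denseD.
  have : forall i, open ((G i `&` ~` closure (D i)) : set R^o) /\
                   dense ((G i `&` ~` closure (D i)) : set R^o).
    move=> i; have [oG dG] := odG i; split.
      by apply: openI => //; apply: closed_openC; exact: closed_closure.
    exact: denseI.
  move=> /Baire/(_ setT)[]; [by exists 0|exact: openT|move=> x [_ GDx]].
  have [d d0 dP] := GV x (fun i iT => (GDx i iT).1) e e0.
  have [N _ NP] := near_infty_natSinv_lt (PosNum d0).
  apply: (GDx N I).2; apply: subset_closure => J iJ cJ Jx J0 JN.
  by apply: dP => //; apply: lt_trans JN _; rewrite lte_fin; apply: NP => /=.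
exists O; split; [exact: oO|by exists x|].
have n0 : 0 < n.+1%:R^-1 :> R by rewrite invr_gt0.
exists (n.+1%:R^-1 / 2); first by rewrite divr_gt0.
move=> y r Oy /andP[r0 rn].
have clDy : closure (D n) y.
  apply: contrapT => nDy.
  by have : (O `&` ~` closure (D n)) y by []; rewrite OD.
have [z [Dz yz]] := clDy _ (nbhsx_ballx y r r0).
rewrite EFinM -(mu_segment y r0); apply: Dz.
- exact: interval_is_interval.
- exact: interval_closed.
- by move: yz; rewrite /ball/= in_itv/= ltr_norml; lra.
- by rewrite mu_segment// lte_fin pmulrn_lgt0.
- by rewrite mu_segment// lte_fin -[r *+ 2]mulr_natr -ltr_pdivlMr.
Qed.

Lemma rat_residual_not_separated U V (G : (set R)^nat) :
  (forall i, open (G i) /\ dense (G i)) ->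
  (forall q : rat, full_density U (ratr q)) ->
  (forall x, (\bigcap_i G i) x -> full_density V x) ->
  U `&` V !=set0.
Proof.
move=> odG QU GV; apply/set0P/eqP => UV0.
(* any bound below 1/2 makes the two relative measures add up to more than 1 *)
have e0 : 0 < 3^-1 :> R by rewrite invr_gt0.
have [ O [oO O0 [d d0 dP]]] := residual_uniform_density e0 odG GV.
have [y [Oy [q _ qy]]] := dense_rat O0 oO.
have Oq : O (ratr q) by rewrite qy.
have [c c0 cP] := QU q _ e0.
pose r : R := Num.min c d / 3.
have m0 : 0 < Num.min c d by rewrite lt_min c0.
have mc : Num.min c d <= c by rewrite ge_min lexx.
have md : Num.min c d <= d by rewrite ge_min lexx orbT.
have r0 : 0 < r by rewrite divr_gt0.
have rE : r = Num.min c d / 3 by [].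
pose J : set R := `[ratr q - r, ratr q + r]%classic.
have JV : (mu (J `\` V) <= (3^-1 * (r *+ 2))%:E)%E.
  by apply: dP => //; apply/andP; split=> //; lra.
have JU : (mu (J `\` U) <= (3^-1 * (r *+ 2))%:E)%E.
  rewrite EFinM -(mu_segment (ratr q) r0); apply: cP.
  - exact: interval_is_interval.
  - exact: interval_closed.
  - by rewrite /J/= in_itv/=; lra.
  - by rewrite mu_segment// lte_fin pmulrn_lgt0.
  - by rewrite mu_segment// lte_fin mulr2n; lra.
have : (mu J <= mu (J `\` U) + mu (J `\` V))%E.
  apply: le_trans (muU _ _); apply: le_mu.
  by rewrite -setDIr UV0 setD0.
move=> /le_trans/(_ (leeD JU JV)).
by rewrite mu_segment// -EFinD lee_fin mulr2n; lra.
Qed.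

Lemma null_rat : mu (range (@ratr R)) = 0%E.
Proof.
apply: countable_lebesgue_measure0.
by apply: card_le_trans (card_image_le _ _) _; exact: countableP.
Qed.

(** A G-delta hull of the null set of rational numbers is null, and residual
    because the rational numbers are dense; removing the countably many
    rational numbers one by one keeps it residual. *)
Lemma null_residual_avoiding_rat : exists G : (set R)^nat,
  [/\ forall i, open (G i) /\ dense (G i),
      range (@ratr R) `&` \bigcap_i G i = set0 &
      mu (\bigcap_i G i) = 0%E].
Proof.
have [H [oH QH muH]] := outer_measure_Gdelta (range (@ratr R)).
pose q i : R := ratr (odflt 0 (unpickle i)).
exists (fun i => H i `&` ~` [set q i]); split=> [i||].
- split; first by apply: openI => //; apply: closed_openC; exact: closed_eq.
  apply: denseI => //; last exact: dense_set1C.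
  move=> O O0 oO; have [y [Oy Qy]] := dense_rat O0 oO.
  by exists y; split=> //; exact: QH.
- apply/seteqP; split=> // _ [[p _ <-] /(_ (pickle p) I)[_]].
  by apply; rewrite /q pickleK.
- apply/eqP; rewrite eq_le mu_ge0 andbT.
  rewrite -(null_rat : _ = 0%E) -[leRHS]muH.
  by apply: le_mu => x Gx i iT; have [] := Gx i iT.
Qed.

End density.

Lemma null_closed_density_line (R : realType) (I : set_system nat)
    (idealI : ideal I) (nontrivialI : nontrivial I)
    (admissibleI : admissible I) (A : set R) : mu A = 0%E ->
  closed (A : set (density_line R idealI nontrivialI admissibleI)).
Proof.
move=> A0; rewrite -openC open_density_lineE.
have CA x : (~` A) x -> full_density (~` A) x.
  by move=> _; exact: full_density_null_setC.
by apply/density_openE => //; split=> //; exact: full_density_measurable.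
Qed.

Theorem theorem7p5 (R : realType) (I : set (set nat)) (idealI : ideal I)
    (nontrivialI : nontrivial I) (admissibleI : admissible I) :
  ~ normal_space (density_line R idealI nontrivialI admissibleI).
Proof.
move=> /(@normal_openP R) sep.
have [G [odG QG G0]] := @null_residual_avoiding_rat R.
have Q0 := @null_rat R.
have [U [V [oU oV QU GV UV0]]] := sep _ _ (null_closed_density_line Q0)
  (null_closed_density_line G0) QG.
have [_ dU] := (density_openE idealI nontrivialI admissibleI U).1 oU.
have [_ dV] := (density_openE idealI nontrivialI admissibleI V).1 oV.
have [|x Gx|x] := @rat_residual_not_separated R U V G odG.
- by move=> q; apply: dU; apply: QU; exists q.
- exact/dV/GV.
- by rewrite UV0.
Qed.
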